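(* For all $m, n, s, k \in \mathbb{Z}_+=\{0,1,2,\dots\}$ with $m+n+s > 3k$, $$\sum_{j=0}^{n+m+s-3k}\binom{n+m+s-3k}{j}(-1)^{j}E_{j+3k} = \begin{cases} 2+E_{n+m+s} & \text{if } k=0,\\[2mm] \displaystyle\sum_{j=0}^{3k}\binom{3k}{j}(-1)^{3k-j}E_{n+m+s-j} & \text{if } k>0.\end{cases}$$
   Context: The Euler numbers $E_n\in\mathbb{Q}$ ($n\ge 0$) are defined by $\frac{2}{e^t+1} = \sum_{n=0}^{\infty} E_n \frac{t^n}{n!}$. *)

(* Defs.v *)
From HB Require Import structures.
From mathcomp Require Import all_boot all_order all_algebra.

Set Implicit Arguments.
Unset Strict Implicit.
Unset Printing Implicit Defensive.

Import Order.TTheory GRing.Theory Num.Theory.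

Local Open Scope ring_scope.

(* [f : fps] stands for the formal power series \sum_n (f n) t^n. *)
Definition fps := nat -> rat.

Definition fps_const (c : rat) : fps := fun n => if n == 0%N then c else 0.

Definition fps_add (f g : fps) : fps := fun n => f n + g n.

Definition fps_mul (f g : fps) : fps :=
  fun n => \sum_(i < n.+1) f i * g (n - i)%N.

Definition fps_exp : fps := fun n => (n`!%:R)^-1.

(* The first n.+1 coefficients of 1 / f, each one obtained by solving
   \sum_(i <= n.+1) g i * f (n.+1 - i) = 0 for g n.+1; meaningful only when
   f 0 != 0. *)
Fixpoint fps_inv_seq (f : fps) (n : nat) : seq rat :=
  if n is n'.+1 then
    let s := fps_inv_seq f n' in
    rcons s (- (f 0%N)^-1 * \sum_(i < n'.+1) s`_i * f (n'.+1 - i)%N)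
  else [:: (f 0%N)^-1].

Definition fps_inv (f : fps) : fps := fun n => (fps_inv_seq f n)`_n.

Definition fps_div (f g : fps) : fps := fps_mul f (fps_inv g).

Definition euler_gf : fps :=
  fps_div (fps_const 2) (fps_add fps_exp (fps_const 1)).

(* E_n / n! is the coefficient of t^n in 2 / (e^t + 1), so E_1 = -1/2; these
   are not the numbers defined by 1 / cosh t. *)
Definition euler (n : nat) : rat := n`!%:R * euler_gf n.

Lemma size_fps_inv_seq f n : size (fps_inv_seq f n) = n.+1.
Proof. by elim: n => //= n IHn; rewrite size_rcons IHn. Qed.

Lemma nth_fps_inv_seq f n i : (i <= n)%N -> (fps_inv_seq f n)`_i = fps_inv f i.
Proof.
elim: n => [|n IHn]; first by case: i.
rewrite leq_eqVlt => /predU1P[-> //|lt_in] /=.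
by rewrite nth_rcons size_fps_inv_seq lt_in IHn.
Qed.

Lemma fps_mulVf f : f 0%N != 0 -> fps_mul (fps_inv f) f =1 fps_const 1.
Proof.
move=> f0 [|n]; first by rewrite /fps_mul big_ord1 /= mulVf.
rewrite /fps_mul big_ord_recr /= subnn /fps_inv /= nth_rcons.
rewrite size_fps_inv_seq ltnn eqxx mulNr mulNr mulrAC mulVf // mul1r.
apply/eqP; rewrite subr_eq0; apply/eqP/eq_bigr => i _.
by rewrite [in RHS]nth_fps_inv_seq // -ltnS.
Qed.

Lemma euler_gfE n :
  euler_gf n = euler n / n`!%:R.
Proof. by rewrite /euler mulrC mulKf // pnatr_eq0 -lt0n fact_gt0. Qed.

Lemma euler_gfP :
  fps_mul (fun n => euler n / n`!%:R) (fps_add fps_exp (fps_const 1))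
    =1 fps_const 2.
Proof.
set d := fps_add _ _; have d0 : d 0%N != 0 by [].
have gfE n : euler n / n`!%:R = 2 * fps_inv d n.
  rewrite -euler_gfE /euler_gf /fps_div /fps_mul big_ord_recl /= subn0.
  by rewrite big1 ?addr0 // => i _; rewrite mul0r.
move=> n; transitivity (2 * fps_mul (fps_inv d) d n).
  by rewrite /fps_mul mulr_sumr; apply: eq_bigr => i _; rewrite gfE mulrA.
by rewrite fps_mulVf // /fps_const; case: eqP; rewrite ?mulr1 ?mulr0.
Qed.

(* Main.v *)
(* Let L be the linear functional on Q[X] with L(X^n) = E_n. The generating
   function says L(p(X+1)) + L(p) = 2 p(0), and this property determines L.
   The functional p |-> L(p(-X-1)) has it too, so L(p(-X-1)) = L(p), whence
   L(p(1-X)) = L(p) + 2 p(1) - 2 p(0). The theorem is the case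
   p = X^a (1-X)^b with a = n+m+s-3k > 0 and b = 3k. *)
Require Import Defs.
From HB Require Import structures.
From mathcomp Require Import all_boot all_order all_algebra.
From mathcomp Require Import ring.

Set Implicit Arguments.
Unset Strict Implicit.
Unset Printing Implicit Defensive.

Import Order.TTheory GRing.Theory Num.Theory.

Local Open Scope ring_scope.

(** Compare coefficients of t^n in [euler_gfP] and multiply by n!: the factor e^t yields the
    binomial sum, the constant 1 yields the lone [euler n]. *)
Lemma euler_rec n :
  \sum_(j < n.+1) 'C(n, j)%:R * euler j + euler n = 2 * (n == 0%N)%:R.
Proof.
have fact0 i : (i`!%:R : rat) != 0 by rewrite pnatr_eq0 -lt0n fact_gt0.
have /(congr1 ( *%R n`!%:R)) := euler_gfP n.
rewrite /fps_mul /fps_add /fps_exp.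
under eq_bigr do rewrite mulrDr.
rewrite big_split /= mulrDr => eqn.
transitivity (n`!%:R * fps_const 2 n); last first.
  by rewrite /fps_const; case: n {eqn} => [|n]; rewrite ?mulr0 // mul1r mulr1.
rewrite -{}eqn; congr (_ + _).
  rewrite mulr_sumr; apply: eq_bigr => i _.
  have le_in : (i <= n)%N by rewrite -ltnS.
  by rewrite -(bin_fact le_in) !natrM; field; rewrite !fact0.
rewrite big_ord_recr /= subnn big1 => [|i _].
  by rewrite add0r mulr1 mulrC divfK.
by rewrite /fps_const subn_eq0 leqNgt ltn_ord mulr0.
Qed.

Definition euler_umbra (p : {poly rat}) : rat :=
  \sum_(i < size p) p`_i * euler i.

(** Linearity compares polynomials of different sizes, so their sums need a common range. *)
Lemma euler_umbra_widen n (p : {poly rat}) :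
  (size p <= n)%N -> euler_umbra p = \sum_(i < n) p`_i * euler i.
Proof.
move=> le_pn; rewrite /euler_umbra (big_ord_widen n (fun i => p`_i * euler i) le_pn).
rewrite big_mkcond; apply: eq_bigr => i _.
by case: ltnP => // le_pi; rewrite nth_default ?mul0r.
Qed.

Fact euler_umbra_is_scalar : scalar euler_umbra.
Proof.
move=> a /= p q; set n := maxn (size p) (size q).
have le_pn : (size p <= n)%N by rewrite leq_maxl.
have le_qn : (size q <= n)%N by rewrite leq_maxr.
have le_pqn : (size (a *: p + q)%R <= n)%N.
  rewrite (leq_trans (size_polyD _ _)) // geq_max le_qn.
  by rewrite (leq_trans (size_scale_leq _ _)).
rewrite !(euler_umbra_widen le_pn, euler_umbra_widen le_qn).
rewrite (euler_umbra_widen le_pqn) mulr_sumr -big_split /=.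
by apply: eq_bigr => i _; rewrite coefD coefZ mulrDl mulrA.
Qed.

HB.instance Definition _ :=
  GRing.isLinear.Build rat {poly rat} rat *%R euler_umbra euler_umbra_is_scalar.

Lemma euler_umbraXn n : euler_umbra 'X^n = euler n.
Proof.
rewrite /euler_umbra size_polyXn big_ord_recr /= coefXn eqxx mul1r.
by rewrite big1 ?add0r // => i _; rewrite coefXn ltn_eqF ?mul0r.
Qed.

Lemma expXD1 (R : comNzRingType) n :
  ('X + 1) ^+ n = \sum_(j < n.+1) 'C(n, j)%:R *: 'X^j :> {poly R}.
Proof.
by rewrite addrC exprDn; apply: eq_bigr => j _; rewrite expr1n mul1r scaler_nat.
Qed.

Lemma scalar_polyE (R : comNzRingType) (M : {scalar {poly R}}) p :
  M p = \sum_(i < size p) p`_i * M 'X^i.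
Proof.
rewrite -[in LHS](coefK p) poly_def linear_sum.
by apply: eq_bigr => i _; rewrite linearZ.
Qed.

(** By linearity it suffices to take p = X^i, where the binomial expansion of (X+1)^i turns the
    claim into [euler_rec]. *)
Lemma euler_umbra_shift p :
  euler_umbra (p \Po ('X + 1)) + euler_umbra p = 2 * p.[0].
Proof.
rewrite -[p](coefK p) poly_def !linear_sum /= horner_sum mulr_sumr.
rewrite -big_split /=; apply: eq_bigr => i _.
rewrite comp_polyZ comp_Xn_poly !linearZ /= -mulrDr hornerZ hornerXn.
rewrite mulrCA expr0n -euler_rec euler_umbraXn expXD1 linear_sum.
by under eq_bigr do rewrite linearZ /= euler_umbraXn.
Qed.

(** For p = X^n the relation gives 2 M(X^n) in terms of M(X^j) with j < n, so strong induction fixes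
    M on every monomial. *)
Lemma euler_umbra_unique (M : {scalar {poly rat}}) :
  (forall p, M (p \Po ('X + 1)) + M p = 2 * p.[0]) -> M =1 euler_umbra.
Proof.
move=> Mshift p; rewrite scalar_polyE; apply: eq_bigr => i _; congr (_ * _).
elim/ltn_ind: {i}(i : nat) => n IHn.
have := Mshift 'X^n; rewrite hornerXn expr0n -euler_rec comp_Xn_poly expXD1.
rewrite linear_sum !big_ord_recr /= !linearZ /= binn !mul1r.
under eq_bigr => j _ do rewrite linearZ /= IHn //.
rewrite -!addrA => /addrI; rewrite -!mulr2n => /eqP.
by rewrite eqr_pMn2r // => /eqP.
Qed.

Lemma euler_umbra_opp p : euler_umbra (p \Po (- 'X - 1)) = euler_umbra p.
Proof.
pose M q := euler_umbra (q \Po (- 'X - 1)).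
have Mlin : scalar M by move=> a q r; rewrite /M !linearP.
pose Mm := GRing.isLinear.Build rat {poly rat} rat *%R M Mlin.
pose ML : {scalar {poly rat}} := HB.pack M Mm.
apply: (@euler_umbra_unique ML) => q; rewrite /= /M.
rewrite -comp_polyA comp_polyD comp_polyX comp_polyC subrK.
(* The shift relation for M at q is that of L at r = q(-X), since r(X+1) = q(-X-1) and r(0) =
   q(0). *)
have := euler_umbra_shift (q \Po - 'X).
rewrite -comp_polyA raddfN /= comp_polyX horner_comp hornerN hornerX oppr0.
by rewrite opprD addrC.
Qed.

Lemma euler_umbra_reflect p :
  euler_umbra (p \Po (1 - 'X)) = euler_umbra p + 2 * (p.[1] - p.[0]).
Proof.
(* Substituting -X-1 into p(X+2) gives p(1-X), so L(p(1-X)) = L(p(X+2)); two shifts then lead back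
   to L(p). *)
have := euler_umbra_opp (p \Po ('X + 1 + 1)).
rewrite -comp_polyA !comp_polyD comp_polyX comp_polyC subrK addrC => ->.
have := euler_umbra_shift (p \Po ('X + 1)); have := euler_umbra_shift p.
rewrite -comp_polyA comp_polyD comp_polyX comp_polyC.
rewrite horner_comp hornerD hornerX hornerC add0r => p0 p1.
by rewrite mulrBr -p0 -p1; ring.
Qed.

(** Expanding (1-X)^a links the polynomial identity to the sums in the theorem; it serves for both
    sides, with the two exponents exchanged. *)
Lemma euler_umbraXnM1BXn a b :
  euler_umbra ('X^b * (1 - 'X) ^+ a) =
  \sum_(0 <= j < a.+1) 'C(a, j)%:R * (-1) ^+ j * euler (j + b).
Proof.
rewrite big_mkord exprDn mulr_sumr linear_sum; apply: eq_bigr => j _ /=.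
rewrite -euler_umbraXn -[RHS]linearZ /=; congr euler_umbra.
rewrite expr1n mul1r [(- 'X) ^+ j]exprNn exprD -mul_polyC polyCM.
by rewrite rmorph_sign polyC_natr -mulr_natl; ring.
Qed.

Theorem corollary9 (m n s k : nat) (hk : (3 * k < m + n + s)%N) :
  \sum_(0 <= j < (n + m + s - 3 * k).+1)
     'C(n + m + s - 3 * k, j)%:R * (-1) ^+ j * euler (j + 3 * k) =
  if k == 0%N then 2 + euler (n + m + s)
  else \sum_(0 <= j < (3 * k).+1)
         'C(3 * k, j)%:R * (-1) ^+ (3 * k - j) * euler (n + m + s - j).
Proof.
move: hk; rewrite [(m + n)%N]addnC; set N := (n + m + s)%N => lt_kN.
have le_kN := ltnW lt_kN; have Nk_gt0 : (0 < N - 3 * k)%N by rewrite subn_gt0.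
rewrite -euler_umbraXnM1BXn.
have -> : 'X^(3 * k) * (1 - 'X) ^+ (N - 3 * k) =
          ('X^(N - 3 * k) * (1 - 'X) ^+ (3 * k)) \Po (1 - 'X) :> {poly rat}.
  rewrite comp_polyM comp_Xn_poly [in RHS]rmorphXn /= comp_polyB comp_polyX.
  by rewrite comp_polyC subKr mulrC.
(* For p = X^(N-3k) (1-X)^(3k), p(0) = 0 because N > 3k, while p(1) = 0^(3k) is 1 exactly when k =
   0; this is the source of the extra 2. *)
rewrite euler_umbra_reflect !hornerE.
rewrite subrr !expr0n !expr1n (gtn_eqF Nk_gt0) mul0r subr0 mul1r.
have [->|k_gt0] := posnP k.
  by rewrite muln0 subn0 expr0 !mulr1 euler_umbraXn addrC.
rewrite muln_eq0 /= (gtn_eqF k_gt0) mulr0 addr0.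
(* Reversing j to 3k-j turns the index j + (N-3k) into N-j and the sign into (-1)^(3k-j). *)
rewrite euler_umbraXnM1BXn big_nat_rev; apply: eq_big_nat => j /andP[_ le_jk].
rewrite add0n subSS bin_sub //; congr (_ * _ * euler _).
by rewrite addnC addnBA // subnK.
Qed.
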